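(* Let $p=\frac12$. For any $(-2,1)$-list system with largest bet size $B^\star$ and any $\epsilon>0$, $$\mathbb{E}\left[B^\star\,(1\vee\log B^\star)^{-(1+\epsilon)}\right]<\infty,\qquad \mathbb{E}\left[B^\star\,(1\vee\log B^\star)\right]=\infty.$$
   Context: Here $x\vee y=\max\{x,y\}$ and $\log$ is the natural logarithm (with $1\vee\log 0=1$). A gambler plays a sequence of independent coups, each won with probability $p$ and lost with probability $1-p$. A $(-2,1)$-list system consists of a target sequence $\{T_n\}_{n\ge0}$, a bet sequence $\{B_n\}_{n\ge1}$ and a length sequence $\{l_n\}_{n\ge0}$ evolving as follows. (1) Initially $T_0>0$ is a (deterministic) real number and $l_0\in\{1,2,\dots\}$. (2) At the $n$-th coup the system makes a bet $B_n\in[0,T_{n-1}]$, which may depend on the entire history (i.e. on the initial data and the outcomes of coups $1,\dots,n-1$). Then $T_n=T_{n-1}-B_n$ and $l_n=(l_{n-1}-2)_+$ if the coup is won, and $T_n=T_{n-1}+B_n$ and $l_n=l_{n-1}+1$ if the coup is lost, where $x_+=\max\{x,0\}$. (3) Termination condition: let $N=\inf\{n: l_n=0\}$ (possibly $\infty$). The system must satisfy $T_n=l_n=0$ for all $n\ge N$ and $B_n=0$ for all $n>N$. (So the evolution rule in (2) applies up to coup $N$.) The largest bet size is $B^\star=\max_{1\le n\le N}B_n$ if $N<\infty$, and $B^\star=\sup_{n\ge1}B_n$ if $N=\infty$. *)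

(* Defs.v *)
From HB Require Import structures.
From mathcomp Require Import all_boot all_order all_algebra.
From mathcomp Require Import finmap.
From mathcomp Require Import all_classical all_reals all_analysis.

Set Implicit Arguments.
Unset Strict Implicit.
Unset Printing Implicit Defensive.

Import Order.TTheory GRing.Theory Num.Theory.
Import numFieldNormedType.Exports.

Local Open Scope classical_set_scope.
Local Open Scope ring_scope.

Definition mutually_independent d (T : measurableType d) (R : realType)
    (P : probability T R) (E : nat -> set T) : Prop :=
  forall J : {fset nat},
    P (\bigcap_(i in [set` J]) E i) = (\prod_(i <- J) P (E i))%E.

(* Coups are numbered from 1: [win n] tells whether coup [n.+1] is won. *)
Definition independent_coups d (T : measurableType d) (R : realType)
    (P : probability T R) (p : R) (win : nat -> T -> bool) : Prop :=
  [/\ forall n, measurable [set w | win n w],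
      forall n, P [set w | win n w] = p%:E &
      mutually_independent P (fun n => [set w | win n w])].

(* The outcomes of coups 1, ..., n. *)
Definition history (T : Type) (win : nat -> T -> bool) (n : nat) (w : T)
    : seq bool :=
  mkseq (fun i => win i w) n.

(* [+oo] when [l] never vanishes, as [ereal_inf set0 = +oo]. *)
Definition termination_time (R : realType) (T : Type) (l : nat -> T -> nat)
    (w : T) : \bar R :=
  ereal_inf [set (n%:R)%:E | n in [set n | l n w = 0%N]].

(* The target sequence is [Tg]; [B 0] is meaningless and left unconstrained.
   Subtraction on [nat] is truncated, so [l n w - 2] is (l_n - 2)_+. *)
Record list_system (R : realType) (T : Type) (win : nat -> T -> bool)
    (Tg B : nat -> T -> R) (l : nat -> T -> nat) : Prop := ListSystem {
  ls_init_target : exists2 T0 : R, 0 < T0 & forall w, Tg 0%N w = T0 ;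
  ls_init_length : exists2 l0 : nat, (0 < l0)%N & forall w, l 0%N w = l0 ;
  ls_history : forall n, exists b : seq bool -> R,
    forall w, B n.+1 w = b (history win n w) ;
  ls_bet_range : forall n w, 0 <= B n.+1 w <= Tg n w ;
  ls_step_win : forall n w, ((n.+1%:R)%:E <= termination_time R l w)%E ->
    win n w -> Tg n.+1 w = Tg n w - B n.+1 w /\ l n.+1 w = (l n w - 2)%N ;
  ls_step_loss : forall n w, ((n.+1%:R)%:E <= termination_time R l w)%E ->
    ~~ win n w -> Tg n.+1 w = Tg n w + B n.+1 w /\ l n.+1 w = (l n w).+1 ;
  ls_stop : forall n w, (termination_time R l w <= (n%:R)%:E)%E ->
    Tg n w = 0 /\ l n w = 0%N ;
  ls_stop_bet : forall n w, (termination_time R l w < (n%:R)%:E)%E ->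
    B n w = 0 }.

(* The supremum of the bets B_n with 1 <= n and n <= N: a maximum over a
   nonempty finite set when N < +oo, the supremum over all n >= 1 when
   N = +oo, in which case it may be infinite. *)
Definition largest_bet (R : realType) (T : Type) (B : nat -> T -> R)
    (l : nat -> T -> nat) (w : T) : \bar R :=
  ereal_sup [set (B n w)%:E | n in
    [set n | (0 < n)%N /\ ((n%:R)%:E <= termination_time R l w)%E]].

(* Main.v *)
(* The target is a nonnegative martingale, so the maximal inequality bounds
   P(B* > x) by T_0 / x; slicing at the levels e^(k+1) turns the first
   expectation into the convergent series of the (k+1)^-(1+eps).  For the
   second, T_n <= T_0 + n B*, and the number of coups played has exponential
   moments because the length drifts down by 1/2.  Young's inequality
   n B* <= (B* log B* + q^n) / log q would then dominate the target on the event
   that play continues, were B* log B* integrable; the mean of T_n would vanish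
   in the limit, whereas it is constantly T_0 > 0. *)
Require Import Defs.
From HB Require Import structures.
From mathcomp Require Import all_boot all_order all_algebra.
From mathcomp Require Import finmap.
From mathcomp Require Import all_classical all_reals all_analysis.
From mathcomp Require Import measurable_realfun ring lra.

Set Implicit Arguments.
Unset Strict Implicit.
Unset Printing Implicit Defensive.

Import Order.TTheory GRing.Theory Num.Theory.
Import numFieldNormedType.Exports.

Local Open Scope classical_set_scope.
Local Open Scope ring_scope.

(** * Quantities determined by the first coups *)

(** Measurability with respect to the first [n] coups, phrased pointwise; since only finitely many
    histories of length [n] exist, no sub-sigma-algebra is involved. *)
Definition known (Omega A : Type) (win : nat -> Omega -> bool) (n : nat)
    (X : Omega -> A) : Prop :=
  forall w w', history win n w = history win n w' -> X w = X w'.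

Lemma historyS (Omega : Type) (win : nat -> Omega -> bool) n w :
  history win n.+1 w = rcons (history win n w) (win n w).
Proof. by rewrite /history /mkseq -addn1 iotaD map_cat cats1. Qed.

Lemma knownS (Omega A : Type) (win : nat -> Omega -> bool) n (X : Omega -> A) :
  known win n X -> known win n.+1 X.
Proof.
by move=> kX w w'; rewrite !historyS => /eqP;
  rewrite eqseq_rcons => /andP[/eqP/kX].
Qed.

Lemma known_le (Omega A : Type) (win : nat -> Omega -> bool) m n
    (X : Omega -> A) : (m <= n)%N -> known win m X -> known win n X.
Proof.
move=> mn kX; rewrite -(subnK mn); elim: (n - m)%N => // k IH.
exact: knownS.
Qed.

Lemma known_win (Omega : Type) (win : nat -> Omega -> bool) n :
  known win n.+1 (win n).
Proof.
by move=> w w'; rewrite !historyS => /eqP; rewrite eqseq_rcons => /andP[_ /eqP].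
Qed.

Lemma known_factor (R : realType) (Omega : Type) (win : nat -> Omega -> bool) n
    (X : Omega -> R) : known win n X -> (forall w, 0 <= X w) ->
  exists2 f : seq bool -> R, (forall s, 0 <= f s) &
    forall w, X w = f (history win n w).
Proof.
move=> kX X0.
pose S s := [set X w | w in [set w | history win n w = s]].
(* The default value 0 keeps [f] nonnegative on the sequences that are the history of no outcome. *)
exists (fun s => xget 0 (S s)) => [s|w];
  first by case: xgetP => // _ _ [w _ <-].
case: xgetP => [_ _ [w' + <-]|/(_ (X w))]; first by move=> /kX.
by move=> /(_ (ex_intro2 _ _ w erefl erefl)).
Qed.

(** * Averaging over one fair coup *)

Section coups.
Context d (Omega : measurableType d) (R : realType) (P : probability Omega R).
Variable win : nat -> Omega -> bool.
Hypothesis coupsP : independent_coups P 2^-1 win.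

Let mwin n : measurable [set w | win n w]. Proof. by case: coupsP. Qed.

Lemma measurable_win n : measurable_fun setT (win n).
Proof.
by apply: (measurable_fun_bool true); rewrite setTI; exact: mwin.
Qed.

Lemma measurable_history d' (A : measurableType d') n (f : seq bool -> A) :
  measurable_fun setT (fun w => f (history win n w)).
Proof.
elim: n f => [|n IH] f; first exact: (@measurable_cst _ _ _ _ setT (f [::])).
have -> : (fun w => f (history win n.+1 w)) = fun w => if win n w
    then f (rcons (history win n w) true)
    else f (rcons (history win n w) false).
  by apply/funext => w; rewrite historyS; case: (win n w).
apply: measurable_fun_ifT; first exact: measurable_win.
- exact: (IH (fun s => f (rcons s true))).
- exact: (IH (fun s => f (rcons s false))).
Qed.

Local Notation wins J := (\bigcap_(i in [set` J]) [set w | win i w]).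

Lemma wins_measurable (J : {fset nat}) : measurable (wins J).
Proof. by apply: bigcap_measurableType => i _; exact: mwin. Qed.

Lemma wins_prob (J : {fset nat}) : P (wins J) = (2^-1 ^+ #|` J|)%:E.
Proof.
case: coupsP => _ P2 ->; under eq_bigr do rewrite P2.
rewrite prodEFin; congr EFin.
by rewrite big_const_seq count_predT iter_mulr_1.
Qed.

(* The wins in [J], all later than coup [n], are carried along because a lost
   coup contributes the difference between no condition and a win. *)
Lemma integral_history_wins n (f : seq bool -> R) : (forall s, 0 <= f s) ->
  exists r : R, forall J : {fset nat}, (forall i, i \in J -> (n <= i)%N) ->
  (\int[P]_(w in wins J) (f (history win n w))%:E = (r * 2^-1 ^+ #|` J|)%:E)%E.
Proof.
elim: n f => [|n IH] f f0.
  exists (f [::]) => J _.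
  rewrite EFinM -wins_prob.
  exact: (integral_cst P (wins_measurable J) (f [::])%:E).
have [rt Hrt] := IH (fun s => f (rcons s true)) (fun s => f0 _).
have [rf Hrf] := IH (fun s => f (rcons s false)) (fun s => f0 _).
(* The last coup of the history is a win or a loss with equal chance, so the mean of [f] is the
   average of the two branch means. *)
exists ((rt + rf) / 2) => J HJ.
have nJ : n \notin J by apply/negP => /HJ; rewrite ltnn.
have HJ1 i : i \in (n |` J)%fset -> (n <= i)%N.
  by rewrite in_fset1U => /orP[/eqP->//|/HJ/ltnW].
have HJ' i : i \in J -> (n <= i)%N by move=> /HJ/ltnW.
have cJ : #|` (n |` J)%fset| = (#|` J|).+1 by rewrite cardfsU1 nJ.
have winsU : wins (n |` J)%fset = wins J `&` [set w | win n w].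
  apply/seteqP; split => w /=.
    move=> H; split; last by apply: (H n); rewrite /= in_fset1U eqxx.
    by move=> i /= iJ; apply: H; rewrite /= in_fset1U iJ orbT.
  by move=> [H1 H2] i /=; rewrite in_fset1U => /orP[/eqP->//|]; exact: H1.
have mh (g : seq bool -> R) m D :
    measurable_fun D (EFin \o (fun w => g (history win m w))).
  by apply/measurable_EFinP/measurable_funTS; exact: measurable_history.
have mN : measurable (wins J `&` ~` [set w | win n w]).
  by apply: measurableI; [exact: wins_measurable|exact/measurableC/mwin].
have mY : measurable (wins J `&` [set w | win n w]).
  by apply: measurableI; [exact: wins_measurable|exact/mwin].
have split_wins (g : seq bool -> R) m : (forall s, 0 <= g s) ->
  (\int[P]_(w in wins J) (g (history win m w))%:E =
   \int[P]_(w in wins J `&` [set w | win n w]) (g (history win m w))%:E +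
   \int[P]_(w in wins J `&` ~` [set w | win n w]) (g (history win m w))%:E)%E.
  move=> g0; rewrite -ge0_integral_setU//.
  - by rewrite -setIUr setUv setIT.
  - exact: mh.
  - by move=> w _; rewrite lee_fin.
  - by apply/disj_setPS => w [[_ ?] [_]].
rewrite split_wins//.
rewrite (_ : \int[P]_(w in wins J `&` [set w | win n w]) _ =
    \int[P]_(w in wins J `&` [set w | win n w])
      (f (rcons (history win n w) true))%:E)%E; last first.
  by apply: eq_integral => w; rewrite inE => -[_ /= nw]; rewrite historyS nw.
rewrite (_ : \int[P]_(w in wins J `&` ~` [set w | win n w]) _ =
    \int[P]_(w in wins J `&` ~` [set w | win n w])
      (f (rcons (history win n w) false))%:E)%E; last first.
  apply: eq_integral => w; rewrite inE => -[_ /= /negP/negbTE nw].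
  by rewrite historyS nw.
have := split_wins (fun s => f (rcons s false)) n (fun s => f0 _).
have := Hrt _ HJ1; have := Hrf _ HJ1; rewrite winsU cJ => -> ->.
(* Only the integral over the loss is still unknown. The other terms of its equation are finite,
   which excludes infinite values and permits the subtraction. *)
rewrite Hrf//; case: integral => [x| |]//; rewrite -!EFinD => -[Ex].
by congr EFin; rewrite (_ : x = rf * 2^-1 ^+ #|` J| - rf * 2^-1 ^+ #|` J|.+1);
  [rewrite !exprS; lra|rewrite Ex; lra].
Qed.

Lemma known_measurable n (X : Omega -> R) : known win n X ->
  (forall w, 0 <= X w) -> measurable_fun setT X.
Proof.
move=> kX X0; have [f _ fX] := known_factor kX X0.
by rewrite (funext fX); exact: measurable_history.
Qed.

Lemma known_measurable_set n (X : Omega -> bool) : known win n X ->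
  measurable [set w | X w].
Proof.
move=> kX; have kR : known win n (fun w => (X w)%:R : R) by move=> w w' /kX ->.
have := known_measurable kR (fun w => ler0n _ _) measurableT
  (measurable_set1 1).
rewrite setTI; congr measurable.
apply/seteqP; split => w /=; last by move=> ->.
by case: (X w) => // /esym/eqP; rewrite oner_eq0.
Qed.

(** The outcome [win n] is independent of the past: [integral_history_wins], applied with no
    prescribed win and with the single win [n], shows that a win and a loss each carry half of the
    integral of a quantity known after [n] coups. *)
Lemma integral_coup n (X Y : Omega -> R) : known win n X -> known win n Y ->
  (forall w, 0 <= X w) -> (forall w, 0 <= Y w) ->
  (\int[P]_w (if win n w then X w else Y w)%:E =
   \int[P]_w ((X w + Y w) / 2)%:E)%E.
Proof.
move=> kX kY X0 Y0.
have half (Z : Omega -> R) : known win n Z ->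
  (forall w, 0 <= Z w) -> exists r : R,
    [/\ \int[P]_w (Z w)%:E = r%:E,
        \int[P]_(w in [set w | win n w]) (Z w)%:E = (r / 2)%:E &
        \int[P]_(w in ~` [set w | win n w]) (Z w)%:E = (r / 2)%:E]%E.
  move=> kZ Z0; have [f f0 fZ] := known_factor kZ Z0.
  have mZ D : measurable_fun D (EFin \o Z).
    by apply/measurable_EFinP/measurable_funTS; exact: known_measurable kZ Z0.
  have [r Hr] := integral_history_wins n f0; exists r.
  have ET : (\int[P]_w (Z w)%:E = r%:E)%E.
    have := Hr fset0; rewrite set_fset0 bigcap_set0 cardfs0 expr0 mulr1.
    by move=> <-//; apply: eq_integral => w _; rewrite fZ.
  have Ew : (\int[P]_(w in [set w | win n w]) (Z w)%:E = (r / 2)%:E)%E.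
    have := Hr [fset n]%fset; rewrite set_fset1 bigcap_set1 cardfs1 expr1.
    move=> <-; first by apply: eq_integral => w _; rewrite fZ.
    by move=> i; rewrite inE => /eqP->.
  split=> //; move: ET; rewrite -(setUv [set w | win n w]).
  rewrite ge0_integral_setU//.
  - rewrite Ew; case: (X in (_ + X)%E) => [x| |]//.
    by rewrite -EFinD => -[xr]; congr EFin; lra.
  - exact: measurableC.
  - by move=> w _; rewrite lee_fin.
  - by apply/disj_setPS => w [].
have [x [x1 x2 x3]] := half X kX X0.
have [y [y1 y2 y3]] := half Y kY Y0.
have mXY (Z : Omega -> R) D : known win n Z -> (forall w, 0 <= Z w) ->
    measurable_fun D (EFin \o Z).
  by move=> kZ Z0; apply/measurable_EFinP/measurable_funTS;
    exact: known_measurable kZ Z0.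
transitivity ((x / 2 + y / 2)%:E).
  rewrite -(setUv [set w | win n w]) ge0_integral_setU//.
  - rewrite EFinD; congr (_ + _)%E; [rewrite -x2|rewrite -y3].
    + by apply: eq_integral => w; rewrite inE /= => ->.
    + by apply: eq_integral => w; rewrite inE /= => /negP/negbTE ->.
  - exact: measurableC.
  - apply/measurable_EFinP/measurable_funTS/measurable_fun_ifT.
    + exact: measurable_win.
    + exact: known_measurable kX X0.
    + exact: known_measurable kY Y0.
  - by move=> w _; case: ifP; rewrite lee_fin.
  - by apply/disj_setPS => w [].
symmetry; under eq_integral do rewrite mulrC EFinM.
rewrite ge0_integralZl//.
- under eq_integral do rewrite EFinD.
  rewrite ge0_integralD//; [|by move=> w _; rewrite lee_fin|exact: mXY
    |by move=> w _; rewrite lee_fin|exact: mXY].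
  by rewrite x1 y1 -EFinD -EFinM; congr EFin; lra.
- under eq_fun do rewrite EFinD.
  by apply: emeasurable_funD; exact: mXY.
- by move=> w _; rewrite lee_fin addr_ge0.
Qed.

End coups.

Lemma integral_probability_cst d (T : measurableType d) (R : realType)
    (P : probability T R) (r : R) : (\int[P]_w r%:E = r%:E)%E.
Proof.
transitivity (r%:E * P setT)%E; first exact: (integral_cst P measurableT).
by rewrite (_ : P setT = 1%E) ?mule1//; exact: probability_setT.
Qed.

Lemma le0_of_cvg0 (R : realType) (x : \bar R) (u : R^nat) : u @ \oo --> 0 ->
  (forall n, (x <= (u n)%:E)%E) -> (x <= 0)%E.
Proof.
move=> u0 xu; have cu : (EFin \o u) @ \oo --> (0 : R)%:E
  by apply: cvg_EFin => //; exact: nearW.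
have <- : limn (EFin \o u) = 0%E by exact: cvg_lim cu.
apply: lime_ge; first exact: cvgP cu.
exact: nearW.
Qed.

(** * Pathwise consequences of the rules of a list system *)

Section system.
Context (R : realType) (Omega : Type) (win : nat -> Omega -> bool).
Variables (Tg B : nat -> Omega -> R) (l : nat -> Omega -> nat).
Hypothesis sysP : list_system win Tg B l.

Lemma termination_le n w : l n w = 0%N ->
  (termination_time R l w <= (n%:R)%:E)%E.
Proof. by move=> ln; apply: ereal_inf_lbound; exists n. Qed.

(** A zero length at some [m <= n] would bring the termination time down to [m], and the stopping
    rule would then force a zero length at [n]. *)
Lemma termination_gt n w : l n w != 0%N ->
  ((n.+1%:R)%:E <= termination_time R l w)%E.
Proof.
move=> ln; apply: le_ereal_inf_tmp => _ [m /= lm <-].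
rewrite lee_fin ler_nat ltnNge; apply/negP => mn.
move/eqP: ln; apply; have := ls_stop sysP (n := n) (w := w); case=> //.
by apply: le_trans (termination_le lm) _; rewrite lee_fin ler_nat.
Qed.

Lemma bet_ge0 n w : 0 <= B n.+1 w.
Proof. by have /andP[] := ls_bet_range sysP n w. Qed.

Lemma bet_le_target n w : B n.+1 w <= Tg n w.
Proof. by have /andP[] := ls_bet_range sysP n w. Qed.

Lemma target_ge0 n w : 0 <= Tg n w.
Proof. exact: le_trans (bet_ge0 n w) (bet_le_target n w). Qed.

Lemma target_stopped n w : l n w = 0%N -> Tg n w = 0.
Proof. by move=> /termination_le /(ls_stop sysP)[]. Qed.

Lemma bet_stopped n w : l n w = 0%N -> B n.+1 w = 0.
Proof.
by move=> /target_stopped T0; apply/eqP;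
  rewrite eq_le bet_ge0 -T0 bet_le_target.
Qed.

Lemma length_stopped n w : l n w = 0%N -> l n.+1 w = 0%N.
Proof.
move=> /termination_le lw; have := ls_stop sysP (n := n.+1) (w := w).
by case=> //; apply: le_trans lw _; rewrite lee_fin ler_nat.
Qed.

(** After termination the bet is squeezed between 0 and a zero target, so the playing rule persists
    for all time and the martingale argument needs no stopping time. *)
Lemma target_step n w : Tg n.+1 w =
  if win n w then Tg n w - B n.+1 w else Tg n w + B n.+1 w.
Proof.
have [ln|/termination_gt tn] := eqVneq (l n w) 0%N.
  rewrite (target_stopped ln) (bet_stopped ln) subr0 addr0 if_same.
  exact/target_stopped/length_stopped.
by case: ifPn => [/(ls_step_win sysP tn)[]|/(ls_step_loss sysP tn)[]].
Qed.

(** Unlike for the target, zero has to be tested here: the rule for a loss would revive a finished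
    list. *)
Lemma length_step n w : l n.+1 w =
  if l n w == 0%N then 0%N else if win n w then (l n w - 2)%N else (l n w).+1.
Proof.
have [/length_stopped//|/termination_gt tn] := eqVneq (l n w) 0%N.
by case: ifPn => [/(ls_step_win sysP tn)[]|/(ls_step_loss sysP tn)[]].
Qed.

Lemma known_bet n : known win n (B n.+1).
Proof. by have [b Bb] := ls_history sysP n; move=> w w' h; rewrite !Bb h. Qed.

Lemma known_target n : known win n (Tg n).
Proof.
elim: n => [|n IH] w w' h; first by have [T0 _ T0E] := ls_init_target sysP;
  rewrite !T0E.
rewrite !target_step (known_win h).
move: h; rewrite !historyS => /eqP; rewrite eqseq_rcons => /andP[/eqP h _].
by rewrite (IH _ _ h) (known_bet h).
Qed.

Lemma known_length n : known win n (l n).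
Proof.
elim: n => [|n IH] w w' h; first by have [l0 _ l0E] := ls_init_length sysP;
  rewrite !l0E.
rewrite !length_step (known_win h).
move: h; rewrite !historyS => /eqP; rewrite eqseq_rcons => /andP[/eqP h _].
by rewrite (IH _ _ h).
Qed.

(** The bets after termination are null and hence do not exceed the first bet, which always counts
    because the initial length is positive. *)
Lemma largest_betE w :
  largest_bet B l w = ereal_sup (range (fun n => (B n.+1 w)%:E)).
Proof.
apply/eqP; rewrite eq_le; apply/andP; split.
  apply: ereal_sup_le => _ [[|n] /= [//_ _] <-]; by exists n.
apply: ge_ereal_sup => _ [n _ <-].
have [ln|ln] := eqVneq (l n w) 0%N; last first.
  by apply: ereal_sup_ubound; exists n.+1 => //; split => //;
    exact: termination_gt.
rewrite (bet_stopped ln); apply: le_trans (_ : ((B 1%N w)%:E <= _)%E).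
  by rewrite lee_fin bet_ge0.
apply: ereal_sup_ubound; exists 1%N => //; split => //; apply: termination_gt.
by have [l0 l0_gt0 ->] := ls_init_length sysP; rewrite -lt0n.
Qed.

Lemma largest_bet_ge n w : ((B n.+1 w)%:E <= largest_bet B l w)%E.
Proof. by rewrite largest_betE; apply: ereal_sup_ubound; exists n. Qed.

Lemma largest_bet_ge0 w : (0 <= largest_bet B l w)%E.
Proof. by apply: le_trans (largest_bet_ge 0 w); rewrite lee_fin bet_ge0. Qed.

Lemma target_le_bets n w x : (forall i, B i.+1 w <= x) ->
  Tg n w <= Tg 0 w + n%:R * x.
Proof.
move=> Bx; elim: n => [|n IH]; first by rewrite mul0r addr0.
rewrite target_step -natr1 mulrDl mul1r addrA; have := Bx n;
  have := bet_ge0 n w.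
by case: ifP => _; lra.
Qed.

End system.

(** * Real estimates behind the two expectations *)

Lemma powRN_le (R : realType) (a x y : R) : 0 <= a -> 0 < x <= y ->
  y `^ (- a) <= x `^ (- a).
Proof.
move=> a0 /andP[x0 xy]; have y0 := lt_le_trans x0 xy.
rewrite !powRN lef_pV2 ?posrE ?powR_gt0//.
by apply: ge0_ler_powR; rewrite ?nnegrE// ltW.
Qed.

(* The mean value inequality for [x^-a], which makes the p-series telescope. *)
Lemma powRN_telescope (R : realType) (a b : R) : 0 < a -> 1 < b ->
  b `^ (- (1 + a)) <= a^-1 * ((b - 1) `^ (- a) - b `^ (- a)).
Proof.
move=> a0 b1; have b0 : 0 < b by lra.
rewrite ler_pdivlMl// opprD powRD; last by rewrite (gt_eqF b0) implybT.
rewrite (powR_inv1 (ltW b0)).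
(* With the common factor [b ^ (-a)] taken out, two tangent-line bounds suffice: [ln (1 + y) <= y]
   at [y = - 1 / b], and [1 + y <= expR y]. *)
have -> : (b - 1) `^ (- a) = b `^ (- a) * expR (- a * (ln (b - 1) - ln b)).
  by rewrite /powR !gt_eqF ?subr_gt0// -expRD; congr expR; ring.
have lnb : ln (b - 1) - ln b <= - b^-1.
  rewrite -ln_div ?posrE ?subr_gt0//.
  rewrite (_ : (b - 1) / b = 1 + - b^-1); last by field; rewrite gt_eqF.
  by apply: le_ln1Dx; rewrite ltrN2 invf_lt1.
rewrite -subr_ge0.
have -> : b `^ (- a) * expR (- a * (ln (b - 1) - ln b)) - b `^ (- a) -
    a * (b^-1 * b `^ (- a)) =
    b `^ (- a) * (expR (- a * (ln (b - 1) - ln b)) - 1 - a * b^-1) by ring.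
apply: mulr_ge0; first exact: powR_ge0.
have := expR_ge1Dx (- a * (ln (b - 1) - ln b)).
have : a * b^-1 <= - a * (ln (b - 1) - ln b) by nra.
lra.
Qed.

Lemma riemann_sum_le (R : realType) (a : R) n : 0 < a ->
  \sum_(0 <= k < n) k.+1%:R `^ (- (1 + a)) <= 1 + a^-1.
Proof.
move=> a0; case: n => [|n].
  by rewrite big_geq// addr_ge0// invr_ge0 ltW.
(* The telescoped remainder is subtracted to make the bound inductive; it is an equality for a
   single term. *)
apply: (@le_trans _ _ (1 + a^-1 - a^-1 * n.+1%:R `^ (- a))); last first.
  by rewrite gerBl mulr_ge0 ?powR_ge0// invr_ge0 ltW.
elim: n => [|n IH]; first by rewrite big_nat1 !powR1; lra.
rewrite big_nat_recr//=.
have n2 : (1 < n.+2%:R :> R) by rewrite ltr1n.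
have := powRN_telescope a0 n2; rewrite -[n.+2%:R]natr1 addrK natr1; lra.
Qed.

Section upper_bound.
Context (R : realType) (eps : R).
Hypothesis eps0 : 0 < eps.

Definition log_damped (x : R) := x * powR (Num.max 1 (ln x)) (- (1 + eps)).

Lemma log_damped_ge0 x : 0 <= x -> 0 <= log_damped x.
Proof. by move=> x0; rewrite mulr_ge0// powR_ge0. Qed.

Lemma measurable_log_damped : measurable_fun setT log_damped.
Proof.
apply: measurable_funM => //.
apply: (measurableT_comp (measurable_powR _)) => //.
by apply: measurable_maxr.
Qed.

(** Below [e] the constant suffices. Otherwise [x] lies in one slice between [e^(k+1)] and
    [e^(k+2)], where the term of index [k] alone dominates. The indicators ask only for the lower
    end, so that they integrate to tail probabilities. *)
Lemma log_damped_le (x : R) : 0 <= x ->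
  ((log_damped x)%:E <= (expR 1)%:E + \sum_(0 <= k <oo)
    (expR k.+2%:R * k.+1%:R `^ (- (1 + eps)) * (expR k.+1%:R < x)%R%:R)%R%:E)%E.
Proof.
move=> x0; have eps1 : 0 <= 1 + eps by rewrite addr_ge0// ltW.
have term_ge0 k : (0 <= (expR k.+2%:R * k.+1%:R `^ (- (1 + eps)) *
    (expR k.+1%:R < x)%R%:R)%R%:E)%E.
  by rewrite lee_fin !mulr_ge0 ?expR_ge0 ?powR_ge0.
have [xe|ex] := leP x (expR 1).
  rewrite -[leLHS]adde0; apply: leeD; last exact: nneseries_ge0.
  rewrite lee_fin; apply: le_trans xe; rewrite -[leRHS]mulr1 ler_wpM2l//.
  have := @powRN_le R (1 + eps) 1 (Num.max 1 (ln x)) eps1; rewrite powR1; apply.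
  by rewrite ltr01 le_max lexx.
have x_gt0 := lt_trans (expR_gt0 1) ex.
have lnx : 1 < ln x by rewrite -(expRK 1) ltr_ln ?posrE ?expR_gt0.
have exn : exists n, ln x <= n%:R.
  by eexists; exact/ltW/truncnS_gt.
(* The least integer above [ln x] is at least 2, as [ln x > 1]; it is written [k.+2], and minimality
   gives [k.+1 < ln x]. *)
case: (ex_minnP exn) => m lnm minm.
have m2 : (1 < m)%N by rewrite -(ltr_nat R); exact: lt_le_trans lnm.
case: m m2 lnm minm => [//|[//|k]] _ lnm minm.
have lnk : k.+1%:R < ln x.
  by rewrite ltNge; apply/negP => /minm; rewrite ltnn.
rewrite -[leLHS]add0e; apply: leeD; first by rewrite lee_fin expR_ge0.
apply: le_trans (nneseries_lim_ge k.+1 (fun n _ _ => term_ge0 n)).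
rewrite big_nat_recr//= -[leLHS]add0e; apply: leeD; first exact: sume_ge0.
have kx : expR k.+1%:R < x by rewrite -[ltRHS]lnK ?posrE// ltr_expR.
rewrite lee_fin kx mulr1; apply: ler_pM => //.
- exact: powR_ge0.
- by rewrite -[leLHS]lnK ?posrE// ler_expR.
- by rewrite max_r ?(ltW lnx)//; apply: powRN_le => //; rewrite ltr0n ltW.
Qed.

End upper_bound.

(* The Legendre duality [u v <= u ln u - u + expR v], rescaled. *)
Lemma young_entropy (R : realType) (q x : R) n : 1 < q -> 0 <= x ->
  n%:R * x <= (ln q)^-1 * (x * Num.max 1 (ln x) + q ^+ n).
Proof.
move=> q1 x0; have q0 : 0 < q := lt_trans ltr01 q1.
rewrite ler_pdivlMl ?ln_gt0//.
have [->|x_gt0] := eqVneq x 0.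
  by rewrite mul0r !mulr0 add0r exprn_ge0// ltW.
have {}x0 : 0 < x by rewrite lt_neqAle eq_sym x_gt0.
(* The bound [1 + y <= expR y] at [y = n ln q - ln x], multiplied by [x]. *)
have : x * (1 + (ln q * n%:R - ln x)) <= q ^+ n.
  have -> : q ^+ n = x * expR (ln q * n%:R - ln x).
    rewrite expRB expRM_natr !lnK ?posrE//.
    by rewrite mulrC divfK// gt_eqF.
  by rewrite ler_pM2l// expR_ge1Dx.
have : x * ln x <= x * Num.max 1 (ln x) by rewrite ler_pM2l// le_max lexx orbT.
lra.
Qed.

(** * Maximal inequality and the first expectation *)

Section system_probability.
Context d (Omega : measurableType d) (R : realType) (P : probability Omega R).
Variables (win : nat -> Omega -> bool) (Tg B : nat -> Omega -> R).
Variable l : nat -> Omega -> nat.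
Hypotheses (coupsP : independent_coups P 2^-1 win)
           (sysP : list_system win Tg B l).

Lemma measurable_largest_bet : measurable_fun setT (largest_bet B l).
Proof.
rewrite (_ : largest_bet B l = fun w => esups (fun n => (B n.+1 w)%:E) 0%N).
  apply: measurable_fun_esups => n; apply/measurable_EFinP.
  exact: (known_measurable coupsP (known_bet sysP (n := n)) (bet_ge0 sysP n)).
apply/funext => w; rewrite (largest_betE sysP) /esups /sdrop.
by congr ereal_sup; apply/seteqP; split => _ [n _ <-]; exists n.
Qed.

Lemma measurable_target n : measurable_fun setT (Tg n).
Proof.
exact: (known_measurable coupsP (known_target sysP (n :=
  n)) (target_ge0 sysP n)).
Qed.

Lemma measurable_largest_bet_gt (x : \bar R) :
  measurable [set w | (x < largest_bet B l w)%E].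
Proof.
have := measurable_largest_bet measurableT (emeasurable_itv `]x, +oo[).
rewrite setTI; congr measurable.
by apply/seteqP; split => w /=; rewrite in_itv /= andbT.
Qed.

(** A fair coup adds or removes the same bet, already fixed by the past, so the mean of the target
    never moves. *)
Lemma integral_target T0 n : (forall w, Tg 0%N w = T0) ->
  (\int[P]_w (Tg n w)%:E = T0%:E)%E.
Proof.
move=> T0E; elim: n => [|n IH].
  under eq_integral do rewrite T0E.
  by exact: integral_probability_cst.
rewrite -IH; under eq_integral do rewrite (target_step sysP).
have kT := known_target sysP (n := n); have kB := known_bet sysP (n := n).
have TB := bet_le_target sysP n; have T_ge0 := target_ge0 sysP n.
have B_ge0 := bet_ge0 sysP n.
rewrite (integral_coup coupsP (n := n) (X := fun w => Tg n w - B n.+1 w)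
  (Y := fun w => Tg n w + B n.+1 w)).
- by apply: eq_integral => w _; congr EFin; lra.
- by move=> w w' h; rewrite (kT _ _ h) (kB _ _ h).
- by move=> w w' h; rewrite (kT _ _ h) (kB _ _ h).
- by move=> w; rewrite subr_ge0.
- by move=> w; rewrite addr_ge0.
Qed.

(** Markov's inequality for a frozen target bounds the chance of a large bet among the first [n];
    continuity from below then lets [n] grow. *)
Lemma prob_largest_bet_gt T0 (lam : R) : (forall w, Tg 0%N w = T0) -> 0 < lam ->
  (P [set w | (lam%:E < largest_bet B l w)%E] <= (T0 / lam)%:E)%E.
Proof.
move=> T0E lam0.
pose hit n w := has (fun i => lam < B i.+1 w) (iota 0 n).
have hitS n w : hit n.+1 w = hit n w || (lam < B n.+1 w).
  have -> : hit n.+1 w = has (fun i => lam < B i.+1 w) (iota 0 n ++ [:: n]).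
    by rewrite /hit -[in LHS]addn1 iotaD.
  by rewrite has_cat /= orbF.
(* The bet at a coup is chosen before its outcome, so hitting within [n.+1] bets is known after only
   [n] coups. *)
have known_hit n : known win n (hit n.+1).
  move=> w w' h; apply: eq_in_has => i; rewrite mem_iota add0n => /andP[_ ilt].
  by rewrite (known_le _ (known_bet sysP (n := i)) h).
(* The target frozen at [lam] by the first bet above [lam]: a supermartingale,
   as such a bet requires a target above [lam]. *)
pose M n w := if hit n w then lam else Tg n w.
have M_ge0 n w : 0 <= M n w.
  by rewrite /M; case: ifP => _; [exact: ltW|exact: (target_ge0 sysP)].
have kM n : known win n (M n).
  move=> w w' h; rewrite /M (known_target sysP h); case: n h => // n h.
  by have /= -> := knownS (known_hit n) h.
have mM n : measurable_fun setT (M n)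
  by exact: (known_measurable coupsP (kM n) (M_ge0 n)).
have MT n : (\int[P]_w (M n w)%:E <= T0%:E)%E.
  elim: n => [|n IH].
    under eq_integral do rewrite /M /= T0E.
    by rewrite (integral_probability_cst P T0) lexx.
  apply: le_trans IH.
  (* [X] and [Z] are the values of [M n.+1] after a win and after a loss. *)
  pose X w := if hit n.+1 w then lam else Tg n w - B n.+1 w.
  pose Z w := if hit n.+1 w then lam else Tg n w + B n.+1 w.
  have TB := bet_le_target sysP n; have T_ge0 := target_ge0 sysP n.
  have B_ge0 := bet_ge0 sysP n.
  have kX : known win n X.
    by move=> w w' h; rewrite /X (known_hit _ _ _ h) (known_bet sysP h)
      (known_target sysP h).
  have kZ : known win n Z.
    by move=> w w' h; rewrite /Z (known_hit _ _ _ h) (known_bet sysP h)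
      (known_target sysP h).
  have X0 w : 0 <= X w by rewrite /X; case: ifP => _;
    [exact: ltW|rewrite subr_ge0].
  have Z0 w : 0 <= Z w by rewrite /Z; case: ifP => _;
    [exact: ltW|rewrite addr_ge0].
  have -> : (\int[P]_w (M n.+1 w)%:E =
      \int[P]_w (if win n w then X w else Z w)%:E)%E.
    apply: eq_integral => w _; rewrite /M /X /Z (target_step sysP).
    by case: ifP => _; case: ifP.
  rewrite (integral_coup coupsP kX kZ X0 Z0).
  apply: ge0_le_integral => //.
  - by move=> w _; rewrite lee_fin divr_ge0// addr_ge0.
  - apply/measurable_EFinP/measurable_funM => //; apply: measurable_funD.
    + exact: (known_measurable coupsP kX X0).
    + exact: (known_measurable coupsP kZ Z0).
  - exact/measurable_EFinP.
  - move=> w _; rewrite lee_fin /X /Z /M hitS; have := TB w; have := B_ge0 w.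
    case: (hit n w) => /=; first by lra.
    by case: ltP => ? ? ?; lra.
have mhit n : measurable [set w | hit n w].
  case: n => [|n]; first by rewrite (_ : mkset _ = set0)//; apply/seteqP; split.
  exact/(known_measurable_set coupsP)/known_hit.
have hitP n : (P [set w | hit n w] <= (T0 / lam)%:E)%E.
  (* Markov's inequality: [lam] times the indicator of [hit n] stays below [M n], whose mean is at
     most [T0]. *)
  rewrite -(@lee_pmul2l _ lam%:E)// -EFinM mulrC divfK ?gt_eqF//.
  apply: le_trans (MT n); rewrite -(setIT [set w | _])
    -(integral_indic P measurableT)//.
  rewrite -ge0_integralZl//; last by rewrite lee_fin ltW.
    apply: ge0_le_integral => //.
    - by move=> w _; rewrite mule_ge0// lee_fin ?ltW.
    - by apply/measurable_EFinP/measurable_funM => //; exact: measurable_indic.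
    - exact/measurable_EFinP.
    - move=> w _; rewrite lee_fin indicE /M; case: (boolP (hit n w)) => h.
        by rewrite mem_set// mulr1.
      by rewrite memNset ?mulr0 ?(target_ge0 sysP)//; exact/negP.
  by apply/measurable_EFinP; exact: measurable_indic.
have -> : [set w | (lam%:E < largest_bet B l w)%E] =
  \bigcup_n [set w | hit n w].
  apply/seteqP; split => w /=.
    rewrite (largest_betE sysP) => /ereal_sup_gt[_ [n _ <-]];
      rewrite lte_fin => h.
    by exists n.+1 => //=; rewrite hitS h orbT.
  move=> [n _ /= /hasP[i _ h]]; apply: lt_le_trans (largest_bet_ge sysP i w).
  by rewrite lte_fin.
have cvgP : P \o (fun n => [set w | hit n w]) @ \oo -->
  P (\bigcup_n [set w | hit n w]).
  apply: nondecreasing_cvg_mu => //; first exact: bigcup_measurable.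
  apply/nondecreasing_seqP => n; apply/subsetPset => w /= h.
  by rewrite hitS h.
rewrite -(cvg_lim _ cvgP)//; apply: lime_le; first by apply/cvg_ex; eexists;
  exact: cvgP.
by apply: nearW => n; exact: hitP.
Qed.

(** The tail bound at level [n.+1] tends to 0. This reduces the first expectation to real values of
    the largest bet, the only ones covered by [log_damped_le]. *)
Lemma largest_bet_fin_ae : P [set w | largest_bet B l w = +oo%E] = 0%E.
Proof.
have [T0 T0_gt0 T0E] := ls_init_target sysP.
apply/eqP; rewrite eq_le measure_ge0 andbT.
apply: (@le0_of_cvg0 _ _ (fun n => T0 * n.+1%:R^-1)).
  by rewrite -(mulr0 T0); apply: cvgM; [exact: cvg_cst|exact: cvg_harmonic].
move=> n; apply: le_trans (prob_largest_bet_gt T0E (ltr0Sn R n)).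
apply: le_measure; rewrite ?inE.
- have := measurable_largest_bet measurableT (emeasurable_set1 +oo%E).
  by rewrite setTI.
- exact: measurable_largest_bet_gt.
- by move=> w /= ->; rewrite ltry.
Qed.

Lemma integral_log_damped_lty eps : 0 < eps ->
  (\int[P]_w er_map (log_damped eps) (largest_bet B l w) < +oo)%E.
Proof.
move=> eps0.
have [T0 T0_gt0 T0E] := ls_init_target sysP.
pose A k := [set w | ((expR k.+1%:R)%:E < largest_bet B l w)%E].
pose u k : R := k.+1%:R `^ (- (1 + eps)).
have u_ge0 k : 0 <= u k by exact: powR_ge0.
have mA k : measurable (A k) by exact: measurable_largest_bet_gt.
pose f k w := (expR k.+2%:R * u k * \1_(A k) w)%:E.
have f_ge0 k w : (0 <= f k w)%E by rewrite lee_fin !mulr_ge0 ?expR_ge0.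
have mf k : measurable_fun setT (f k).
  by apply/measurable_EFinP; apply: measurable_funM => //;
    exact: measurable_indic.
have mF : measurable_fun setT (fun w => (\sum_(0 <= k <oo) f k w)%E).
  exact: ge0_emeasurable_sum.
apply: (@le_lt_trans _ _ (\int[P]_w ((expR 1)%:E + \sum_(0 <= k <oo) f k w))%E).
  apply: ae_ge0_le_integral => //.
  - move=> w _; have := largest_bet_ge0 sysP w; case: largest_bet => //= r r0.
    by rewrite lee_fin log_damped_ge0.
  - apply: measurableT_comp measurable_largest_bet.
    exact: (@measurable_er_map _ Omega _ _ (measurable_log_damped eps)).
  - by move=> w _; rewrite adde_ge0// ?lee_fin ?expR_ge0// nneseries_ge0.
  - exact: emeasurable_funD.
  - exists [set w | largest_bet B l w = +oo%E]; split.
    + have := measurable_largest_bet measurableT (emeasurable_set1 +oo%E).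
      by rewrite setTI.
    + exact: largest_bet_fin_ae.
    + move=> w /= fail; apply: contrapT => fin; apply: fail => _.
      have := largest_bet_ge0 sysP w; move: fin.
      case Ew: (largest_bet B l w) => [r| |]//= _; rewrite lee_fin => r0.
      apply: le_trans (log_damped_le eps0 r0) _; rewrite leeD2l//.
      apply: lee_nneseries => [k _ _|k _];
        first by rewrite lee_fin !mulr_ge0 ?expR_ge0 ?powR_ge0.
      rewrite /f indicE lee_fin -/(u k); case: ltP => [rk|_];
        last by rewrite mulr0 !mulr_ge0 ?expR_ge0.
      by rewrite mem_set// /A /= Ew lte_fin.
rewrite ge0_integralD//; last by move=> w _; exact: nneseries_ge0.
rewrite integral_probability_cst lte_add_pinfty ?ltry// integral_nneseries//.
(* The tail bound [T0 / e^(k+1)] cancels the weight [e^(k+2)] up to a factor [e], leaving a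
   convergent p-series. *)
apply: (@le_lt_trans _ _ (\sum_(0 <= k <oo) (T0 * expR 1 * u k)%:E)%E).
  apply: lee_nneseries => [k _ _|k _]; first exact: integral_ge0.
  rewrite /f; under eq_integral do rewrite EFinM.
  rewrite ge0_integralZl//; last 2 first.
  - by apply/measurable_EFinP; exact: measurable_indic.
  - by rewrite lee_fin mulr_ge0 ?expR_ge0.
  rewrite integral_indic// setIT.
  apply: (@le_trans _ _ ((expR k.+2%:R * u k)%:E * (T0 / expR k.+1%:R)%:E)%E).
    rewrite lee_pmul2l ?lte_fin ?mulr_gt0 ?expR_gt0 ?powR_gt0//.
    exact: (prob_largest_bet_gt T0E (expR_gt0 _)).
  rewrite -EFinM lee_fin (_ : k.+2%:R = 1 + k.+1%:R :> R) ?expRD ?nat1r//.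
  by rewrite le_eqVlt; apply/orP; left; apply/eqP; field;
    rewrite gt_eqF ?expR_gt0.
apply: (@le_lt_trans _ _ (T0 * expR 1 * (1 + eps^-1))%:E); last exact: ltry.
apply: lime_le.
  by apply: is_cvg_nneseries => k _ _;
    rewrite lee_fin !mulr_ge0 ?expR_ge0// ltW.
apply: nearW => n; rewrite sumEFin lee_fin -mulr_sumr ler_wpM2l
  ?riemann_sum_le//.
by rewrite mulr_ge0 ?expR_ge0// ltW.
Qed.

(** * Duration of play and the second expectation *)

Let running n := [set w | l n w != 0%N].

Lemma measurable_running n : measurable (running n).
Proof.
apply: (known_measurable_set coupsP (n := n)) => w w' h.
by rewrite (known_length sysP h).
Qed.

(* With [x = 5/4], a coup multiplies the mean of [x ^+ l n] on [running n] by at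
   most [(x + x^-2) / 2 = 189/200]. *)
Lemma prob_running_le l0 n : (forall w, l 0%N w = l0) ->
  (P (running n) <= ((5 / 4) ^+ l0 * (189 / 200) ^+ n)%:E)%E.
Proof.
move=> l0E; pose x : R := 5 / 4.
have x_gt0 : 0 < x by rewrite /x; lra.
(* At length 0 the value is 0 instead of [x ^+ 0 = 1], so finished plays drop out of the mean. *)
pose Z n w := if l n w == 0%N then 0 else x ^+ l n w.
have Z_ge0 k w : 0 <= Z k w by rewrite /Z; case: ifP => _ //;
  rewrite exprn_ge0// ltW.
have kZ k : known win k (Z k) by move=> w w' h;
  rewrite /Z (known_length sysP h).
have mZ k : measurable_fun setT (Z k)
  by exact: (known_measurable coupsP (kZ k) (Z_ge0 k)).
have ZE k : (\int[P]_w (Z k w)%:E <= (x ^+ l0 * (189 / 200) ^+ k)%:E)%E.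
  elim: k => [|k IH].
    rewrite expr0 mulr1 -(integral_probability_cst P).
    apply: ge0_le_integral => //.
    - by move=> w _; rewrite lee_fin.
    - exact/measurable_EFinP.
    - by move=> w _; rewrite lee_fin /Z l0E; case: ifP => // _;
        rewrite exprn_ge0// ltW.
  pose X w := if (l k w <= 2)%N then 0 else x ^+ (l k w - 2).
  pose Y w := if l k w == 0%N then 0 else x ^+ (l k w).+1.
  have X_ge0 w : 0 <= X w by rewrite /X; case: ifP => _ //;
    rewrite exprn_ge0// ltW.
  have Y_ge0 w : 0 <= Y w by rewrite /Y; case: ifP => _ //;
    rewrite exprn_ge0// ltW.
  have kX : known win k X by move=> w w' h; rewrite /X (known_length sysP h).
  have kY : known win k Y by move=> w w' h; rewrite /Y (known_length sysP h).
  have -> : (\int[P]_w (Z k.+1 w)%:E =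
      \int[P]_w (if win k w then X w else Y w)%:E)%E.
    apply: eq_integral => w _; rewrite /Z /X /Y (length_step sysP).
    by case: (l k w) => [|[|[|j]]]; case: (win k w).
  rewrite (integral_coup coupsP kX kY X_ge0 Y_ge0).
  apply: (@le_trans _ _ (\int[P]_w ((189 / 200)%:E * (Z k w)%:E))%E).
    apply: ge0_le_integral => //.
    - by move=> w _; rewrite lee_fin divr_ge0// addr_ge0.
    - apply/measurable_EFinP/measurable_funM => //; apply: measurable_funD.
      + exact: (known_measurable coupsP kX X_ge0).
      + exact: (known_measurable coupsP kY Y_ge0).
    - by apply/measurable_EFinP/measurable_funM.
    - move=> w _; rewrite -EFinM lee_fin /X /Y /Z.
      (* From lengths 1 and 2 a win ends play and contributes nothing; from length 3 on the ratio is
         exactly [189/200]. *)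
      case: (l k w) => [|[|[|j]]] /=; rewrite ?expr1 ?expr2 ?exprS /x; try lra.
  rewrite ge0_integralZl//; [|exact/measurable_EFinP|by move=> w _;
    rewrite lee_fin].
  apply: le_trans (lee_wpmul2l _ IH) _; first by rewrite lee_fin; lra.
  by rewrite -EFinM lee_fin exprS mulrCA.
(* Since [x >= 1], the indicator of [running n] is at most [Z n]. *)
apply: le_trans (ZE n); rewrite -(setIT (running n))
  -(integral_indic P measurableT).
  apply: ge0_le_integral => //.
  - by apply/measurable_EFinP; exact/measurable_indic/measurable_running.
  - exact/measurable_EFinP.
  - move=> w _; rewrite lee_fin indicE /Z; case: (boolP (l n w == 0%N)) => ln.
      by rewrite memNset//= => /negP; apply.
    by rewrite mem_set// exprn_ege1// /x; lra.
exact: measurable_running.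
Qed.

Lemma integral_log_largest_bet : (\int[P]_w
  er_map (fun x : R => (x * Num.max 1 (ln x))%R) (largest_bet B l w) = +oo)%E.
Proof.
have [T0 T0_gt0 T0E] := ls_init_target sysP.
have [l0 l0_gt0 l0E] := ls_init_length sysP.
set phi := fun x : R => x * Num.max 1 (ln x).
pose Phi w := er_map phi (largest_bet B l w).
have Phi_ge0 w : (0 <= Phi w)%E.
  rewrite /Phi; have := largest_bet_ge0 sysP w; case: largest_bet => //= r r0.
  by rewrite lee_fin mulr_ge0// le_max ler01.
have mPhi : measurable_fun setT Phi.
  apply: measurableT_comp measurable_largest_bet.
  apply: (@measurable_er_map _ Omega); apply: measurable_funM => //.
  exact: measurable_maxr.
apply: contrapT => /eqP; rewrite -ltey => Phi_lty.
have iPhi : P.-integrable setT Phi.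
  apply/integrableP; split => //.
  by under eq_integral do rewrite gee0_abs//.
(* The base [q] exceeds 1, as the entropy inequality requires, yet [q * rho = 3969/4000 < 1], so
   that [q ^+ n] is beaten by the decay of the chance of running. *)
pose q : R := 21 / 20; have q1 : 1 < q by rewrite /q; lra.
pose c := (ln q)^-1; have c0 : 0 < c by rewrite invr_gt0 ln_gt0.
pose K : R := (5 / 4) ^+ l0; have K0 : 0 <= K by rewrite exprn_ge0//; lra.
pose rho : R := 189 / 200; have rho0 : 0 <= rho by rewrite /rho; lra.
have stay_stopped m n w : (m <= n)%N -> l m w = 0%N -> l n w = 0%N.
  by move=> /subnK <-; elim: (n - m)%N => // k IH /IH /(length_stopped sysP).
pose f n w := ((\1_(running n) w)%:E * Phi w)%E.
have mf n : measurable_fun setT (f n).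
  apply: emeasurable_funM => //; apply/measurable_EFinP.
  exact/measurable_indic/measurable_running.
(* Dominated convergence under [Phi]: almost every play ends, after which its indicator stays 0. *)
have f_cvg0 : (\int[P]_w f n w)%E @[n --> \oo] --> 0%E.
  have mN : measurable (\bigcap_n running n).
    by apply: bigcap_measurableType => n _; exact: measurable_running.
  have N0 : P (\bigcap_n running n) = 0%E.
    apply/eqP; rewrite eq_le measure_ge0 andbT.
    apply: (@le0_of_cvg0 _ _ (geometric K rho)).
      by apply: cvg_geometric; rewrite ger0_norm// /rho; lra.
    move=> n; apply: le_trans (prob_running_le n l0E).
    by apply: le_measure; rewrite ?inE//;
      [exact: measurable_running|exact: bigcap_inf].
  have [| |_ _] := @dominated_convergence _ _ _ P setT measurableT
    f (cst 0%E) Phi mf (measurable_cst _) _ iPhi.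
  - exists (\bigcap_n running n); split => // w /= fail.
    apply: contrapT => /existsNP[m /not_implyP[_ /negP]];
      rewrite negbK => /eqP lm.
    apply: fail => _; apply: cvg_near_cst; exists m => // n /= mn.
    rewrite /f indicE memNset ?mul0e//= => /negP; apply;
      exact/eqP/(stay_stopped _ _ _ mn).
  - apply: aeW => w n _; rewrite gee0_abs ?mule_ge0 ?lee_fin// /f indicE.
    by case: (_ \in _); rewrite ?mul1e ?mul0e.
  by rewrite integral0.
have coef0 n : 0 <= T0 + c * q ^+ n.
  by rewrite addr_ge0 ?ltW// mulr_gt0// exprn_gt0// (lt_trans _ q1).
have m1 n : measurable_fun setT (\1_(running n) : Omega -> R).
  exact/measurable_indic/measurable_running.
have f_ge0 n w : (0 <= f n w)%E by rewrite mule_ge0// lee_fin.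
(* The left side is the mean of the target at time [n]. The target vanishes off [running n]; there
   it is at most [T0] plus [n] times the largest bet, to which [young_entropy] applies. *)
have TE n : (T0%:E <= ((T0 + c * q ^+ n) * (K * rho ^+ n))%R%:E +
    c%:E * \int[P]_w f n w)%E.
  rewrite -(integral_target n T0E).
  apply: (@le_trans _ _ (\int[P]_w
     (((T0 + c * q ^+ n) * \1_(running n) w)%R%:E + c%:E * f n w))%E).
    apply: ge0_le_integral => //.
    - by move=> w _; rewrite lee_fin (target_ge0 sysP).
    - exact/measurable_EFinP/measurable_target.
    - apply: emeasurable_funD; last exact: measurable_funeM.
      by apply/measurable_EFinP/measurable_funM.
    - move=> w _; have [ln|ln] := eqVneq (l n w) 0%N.
        rewrite (target_stopped sysP ln) adde_ge0 ?mule_ge0 ?lee_fin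
          ?(ltW c0)//.
        by rewrite mulr_ge0.
      rewrite /f indicE mem_set// mulr1 mul1e /Phi.
      have Bge i := largest_bet_ge sysP i w.
      case: (largest_bet B l w) Bge => [r| |] Bge /=; last 2 first.
      (* If the largest bet is infinite, so is the right side. *)
      + by rewrite gt0_muley ?lte_fin// addey// leey.
      + by have := Bge 0%N.
      rewrite -EFinM -EFinD lee_fin.
      have r0 : 0 <= r by apply: le_trans (bet_ge0 sysP 0 w) _;
        rewrite -lee_fin.
      have := target_le_bets sysP n (w := w) (x := r); rewrite T0E => TB.
      apply: le_trans (TB _) _; first by move=> i; rewrite -lee_fin.
      by have := young_entropy n q1 r0; rewrite -/c -/(phi r); lra.
  rewrite ge0_integralD//; last 4 first.
  - by move=> w _; rewrite lee_fin mulr_ge0.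
  - by apply/measurable_EFinP/measurable_funM.
  - by move=> w _; rewrite mule_ge0 ?lee_fin ?(ltW c0).
  - exact: measurable_funeM.
  rewrite ge0_integralZl//; last by rewrite lee_fin ltW.
  rewrite leeD2r//; under eq_integral do rewrite EFinM.
  rewrite ge0_integralZl//; [|exact/measurable_EFinP|by rewrite lee_fin].
  rewrite integral_indic ?setIT//; last exact: measurable_running.
  by rewrite EFinM lee_wpmul2l ?lee_fin// prob_running_le.
(* The product is a sum of two geometric sequences, with ratios [rho] and [q * rho]. *)
have a_cvg0 : (fun n => (T0 + c * q ^+ n) * (K * rho ^+ n)) @ \oo --> (0 : R).
  rewrite (_ : (fun _ => _) =
    geometric (T0 * K) rho \+ geometric (c * K) (q * rho)).
    rewrite -[0 in X in _ --> X](addr0 0); apply: cvgD; apply: cvg_geometric.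
      by rewrite ger0_norm// /rho; lra.
    by rewrite ger0_norm /q /rho; lra.
  by apply/funext => n; rewrite /geometric /= [(q * rho) ^+ n]exprMn; ring.
(* Both terms of the bound [TE] vanish in the limit, which contradicts [T0 > 0]. *)
suff : (T0%:E <= 0%:E)%E by rewrite lee_fin leNgt T0_gt0.
have cvgR : ((((T0 + c * q ^+ n) *
  (K * rho ^+ n))%R%:E + c%:E * \int[P]_w f n w)%E
    @[n --> \oo] --> (0%:E + c%:E * 0)%E).
  apply: cvgeD => //.
    by apply: cvg_EFin => //; exact: nearW.
  exact: cvgeZl.
rewrite -[leRHS]adde0 -[X in (_ + X)%E](mule0 c%:E) -(cvg_lim _ cvgR)//.
apply: lime_ge; first exact: cvgP cvgR.
exact: nearW.
Qed.

End system_probability.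

(* [er_map f] sends +oo to +oo, the limit of both integrands at +oo; and
   [ln 0 = 0], so that [Num.max 1 (ln 0) = 1]. *)
Theorem theorem3 (R : realType) (d : measure_display) (Omega : measurableType d)
    (P : probability Omega R) (win : nat -> Omega -> bool)
    (Tg B : nat -> Omega -> R) (l : nat -> Omega -> nat) (eps : R) :
  independent_coups P 2^-1 win ->
  list_system win Tg B l ->
  0 < eps ->
  (\int[P]_w er_map (fun x : R => (x * powR (Num.max 1 (ln x)) (- (1 + eps)))%R)
     (largest_bet B l w) < +oo)%E /\
  (\int[P]_w er_map (fun x : R => (x * Num.max 1 (ln x))%R)
     (largest_bet B l w) = +oo)%E.
Proof.
move=> coupsP sysP eps0; split;
  first exact: (integral_log_damped_lty coupsP sysP eps0).
exact: (integral_log_largest_bet coupsP sysP).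
Qed.
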